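(* Let $N$ be a matroid. For all $\varepsilon > 0$ there exist $\delta > 0$ and $r_0 \in \mathbb{Z}^+$ such that, if $r \ge r_0$ and $M$ is an $N$-free matroid of rank $r$ with $|M| \ge (1-2^{1-\chi(N)} - \delta)2^{r}$, then $|M \,\Delta\, B| < \varepsilon 2^{r}$ for some matroid $B \cong \mathrm{BB}(r-1,2,\chi(N)-1)$.
   Context: A matroid of dimension $m$ is a set $M \subseteq \mathbb{F}_2^m \setminus \{0\}$. Two matroids $M\subseteq\mathbb{F}_2^m$, $M'\subseteq \mathbb{F}_2^m$ are isomorphic if there is a linear bijection $\varphi$ of $\mathbb{F}_2^m$ with $\varphi(M') = M$. A subset of $M \subseteq \mathbb{F}_2^m$ that is the image of $N \subseteq \mathbb{F}_2^k$ under an injective linear map $\mathbb{F}_2^k \to \mathbb{F}_2^m$ is an $N$-restriction of $M$; $M$ is $N$-free if it has no $N$-restriction. The rank $r(M)$ of $M \subseteq \mathbb{F}_2^m$ is the smallest dimension of a subspace of $\mathbb{F}_2^m$ containing $M$. The critical number $\chi(N)$ of $N \subseteq \mathbb{F}_2^k$ is the smallest codimension of a subspace of $\mathbb{F}_2^k$ disjoint from $N$. The Bose-Burton geometry $\mathrm{BB}(r-1,2,s)$ is the $r$-dimensional matroid consisting of the complement in $\mathbb{F}_2^r$ of an $(r-s)$-dimensional subspace. $\Delta$ denotes symmetric difference. *)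

(* Defs.v *)
From mathcomp Require Import all_boot all_order all_algebra.
From mathcomp Require Import boolp reals.

Set Implicit Arguments.
Unset Strict Implicit.
Unset Printing Implicit Defensive.

Import GRing.Theory.
Local Open Scope ring_scope.

Record matroid (m : nat) := Matroid {
  mset :> {set 'rV['F_2]_m};
  mset_notin0 : 0 \notin mset }.

Definition is_restriction (k m : nat) (N : matroid k) (M : matroid m)
    (S : {set 'rV['F_2]_m}) : Prop :=
  S \subset M /\
  exists phi : {linear 'rV['F_2]_k -> 'rV['F_2]_m},
    injective phi /\ S = [set phi x | x in N].

Definition matroid_free (k m : nat) (N : matroid k) (M : matroid m) : Prop :=
  ~ exists S : {set 'rV['F_2]_m}, is_restriction N M S.

Definition matroid_iso (m : nat) (M M' : matroid m) : Prop :=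
  exists phi : {linear 'rV['F_2]_m -> 'rV['F_2]_m},
    bijective phi /\ [set phi x | x in M'] = M.

Definition is_spanning_dim (m : nat) (M : matroid m) (d : nat) : Prop :=
  exists U : {vspace 'rV['F_2]_m}, \dim U = d /\ {subset M <= U}.

Lemma ex_spanning_dim (m : nat) (M : matroid m) :
  exists d, `[< is_spanning_dim M d >].
Proof.
exists (\dim (fullv : {vspace 'rV['F_2]_m})); apply/asboolP.
by exists fullv; split=> // v _; rewrite memvf.
Qed.

Definition rank (m : nat) (M : matroid m) : nat := ex_minn (ex_spanning_dim M).

Definition is_disjoint_codim (k : nat) (N : matroid k) (c : nat) : Prop :=
  exists U : {vspace 'rV['F_2]_k},
    (k - \dim U)%N = c /\ forall x, x \in N -> x \notin U.

Lemma ex_disjoint_codim (k : nat) (N : matroid k) :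
  exists c, `[< is_disjoint_codim N c >].
Proof.
exists (k - \dim (0%VS : {vspace 'rV['F_2]_k}))%N; apply/asboolP.
exists 0%VS; split=> // x xN; rewrite memv0.
by apply: contraNneq (mset_notin0 N) => <-.
Qed.

Definition critical_number (k : nat) (N : matroid k) : nat :=
  ex_minn (ex_disjoint_codim N).

(* [is_bose_burton s B], for B of dimension r, says that B is a copy of
   BB(r-1,2,s): the complement of a subspace of dimension r - s.  There is no
   such B when r < s. *)
Definition is_bose_burton (r s : nat) (B : matroid r) : Prop :=
  exists U : {vspace 'rV['F_2]_r},
    (\dim U + s)%N = r /\ mset B = [set x | x \notin U].

Definition symdiff (T : finType) (A B : {set T}) : {set T} :=
  (A :\: B) :|: (B :\: A).

(* Main.v *)
From HB Require Import structures.
Require Import Defs.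
From mathcomp Require Import all_boot all_order all_algebra finfield zify.
From mathcomp Require Import boolp reals ring lra.

Set Implicit Arguments.
Unset Strict Implicit.
Unset Printing Implicit Defensive.

Import Order.TTheory GRing.Theory Num.Theory.
Local Open Scope ring_scope.

(** Put [c = chi(N) - 1] and let [D] be the complement of [M], inside the span
    [V] of [M]; the density hypothesis reads [|D| <= (2^-c + delta) |V|].
    As [N] avoids a subspace of codimension [c + 1], [M] contains no blow-up:
    there are no [X] of dimension [c + 1] and [U] of dimension [dim N - c - 1]
    with [x + U] inside [M] for all nonzero [x] in [X].

    A dense set contains affine subspaces of any fixed dimension.  So if [M]
    blows up [X] over a large [U] and a positive proportion of the translates
    of [X] lie in [M], then [M] blows up some [X + <h>] over a smaller [U'].
    Starting from a single point [p], the density of [M] allows this to be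
    iterated up to dimension [c]; this works for all but few [p] in [M].  For
    such a [p], [X] of dimension [c] contains [p] and, [M] having no blow-up of
    dimension [c + 1], almost every translate of [X] meets [D].  As
    [|X| |D|] is about [|V|], almost every translate meets [D] exactly once, so
    [D] and [D + p] are almost disjoint.

    Therefore a sum of two elements of [D] is rarely in [M]: [D] is almost
    closed under addition, hence close to a subspace, whose codimension is [c]
    by cardinality. *)

(** * Pair counts, and affine subspaces of dense sets *)

Section BinarySpace.
Variable n : nat.
Notation V := 'rV['F_2]_n.
Implicit Types (x y z p : V) (A B D M S : {set V}) (U X L : {vspace V}).

Lemma addrr2 x : x + x = 0.
Proof. by apply/rowP=> i; rewrite !mxE addrr_pchar2 // pchar_Fp. Qed.

Lemma addK2 y : involutive (fun x => x + y).
Proof. by move=> x; rewrite -addrA addrr2 addr0. Qed.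

Lemma scaleF2 (a : 'F_2) x : a *: x = if a == 0 then 0 else x.
Proof.
have [->|a_neq0] := eqVneq a 0; first by rewrite scale0r.
suff -> : a = 1 by rewrite scale1r.
by apply/val_inj; case: a a_neq0 => [[|[|[]]]].
Qed.

Lemma card_vspaceF2 U : #|U| = (2 ^ \dim U)%N.
Proof. by rewrite card_vspace card_Fp. Qed.

Lemma card_rVF2 : #|{: V}| = (2 ^ n)%N.
Proof. by rewrite card_mx card_Fp // mul1n. Qed.

Lemma dim_rVF2 : \dim {: V} = n.
Proof. by rewrite dimvf /dim /= mul1n. Qed.

Lemma vspace_of_addclosed S :
  0 \in S -> {in S &, forall x y, x + y \in S} -> exists L, L =i S.
Proof.
move=> S0 SD; exists <<enum S>>%VS => x; apply/idP/idP => [xL|xS]; last first.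
  by apply: memv_span; rewrite mem_enum.
rewrite (@coord_span _ _ _ (in_tuple (enum S)) x xL).
apply: (big_ind (fun z => z \in S)) => // i _; rewrite scaleF2.
by case: ifP => // _; rewrite -mem_enum mem_nth.
Qed.

Lemma card_vspace_add_line U y : (#|(U + <[y]>)%VS| <= 2 * #|U|)%N.
Proof.
rewrite !card_vspaceF2 -expnS leq_exp2l //.
apply: leq_trans (leq_of_leqif (dimv_add_leqif _ _)) _.
by rewrite dim_vline; case: eqP; rewrite /= ?addn0 ?addn1.
Qed.

Definition self_overlap A y := [set x in A | x + y \in A].

Lemma card_self_overlap A y : (#|self_overlap A y| <= #|A|)%N.
Proof. by apply/subset_leq_card/subsetP=> x; rewrite inE => /andP[]. Qed.

Lemma sum_self_overlap A U : {subset A <= U} ->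
  (\sum_(y in U) #|self_overlap A y| = #|A| * #|A|)%N.
Proof.
move=> AU.
have -> : (\sum_(y in U) #|self_overlap A y|
           = \sum_(y in U) \sum_(x in A) (x + y \in A)%R)%N.
  apply: eq_bigr => y _; rewrite -sum1_card big_mkcond /= [RHS]big_mkcond /=.
  by apply: eq_bigr => x _; rewrite !inE; case: (x \in A); case: (x + y \in A).
rewrite exchange_big /= -sum_nat_const.
apply: eq_bigr => x xA.
rewrite (reindex_inj (inv_inj (addK2 x))) /= -sum1_card big_mkcond /=.
rewrite [RHS]big_mkcond /=; apply: eq_bigr => y _.
rewrite [x + _]addrC addK2; have [/AU yU|_] := boolP (y \in A).
  by rewrite (memvD yU (AU _ xA)).
by case: ifP.
Qed.

(* The [y] in [X] account for at
   most [#|X| * #|A|] of the [#|A| ^ 2] pairs. *)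
Lemma popular_difference q A U X : {subset A <= U} ->
    (#|U| <= q * #|A|)%N -> (2 * q * #|X| < #|U|)%N ->
  exists y, [/\ y \in U, y \notin X & #|U| <= 2 * q ^ 2 * #|self_overlap A y|]%N.
Proof.
move=> AU Ubig Xsmall.
suff: [exists y, [&& y \in U, y \notin X & #|U| <= 2 * q ^ 2 * #|self_overlap A y|]%N].
  by case/existsP=> y /and3P[]; exists y.
apply: contraT; rewrite negb_exists => /forallP noy.
have popX : (\sum_(y in U | y \in X) #|self_overlap A y| <= #|X| * #|A|)%N.
  rewrite -sum_nat_const [leqRHS]big_mkcond /= big_mkcond /=.
  apply: leq_sum => y _; have := card_self_overlap A y.
  by case: (y \in U); case: (y \in X).
have popU : (2 * q ^ 2 * \sum_(y in U | y \notin X) #|self_overlap A y|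
              <= #|U| * #|U|)%N.
  rewrite big_distrr /= -sum_nat_const [leqRHS]big_mkcond /= big_mkcond /=.
  apply: leq_sum => y _; have := noy y; rewrite !negb_and negbK.
  by case: (y \in U); case: (y \in X) => //=; rewrite -ltnNge => /ltnW.
have := sum_self_overlap AU; rewrite (bigID (fun y => y \in X)) /=.
set a := #|A| in Ubig popX *; set u := #|U| in Ubig Xsmall popU *.
set s := (\sum_(y in U | y \in X) _)%N in popX *.
set s' := (\sum_(y in U | y \notin X) _)%N in popU *.
set v := #|X| in Xsmall popX *.
(* Unpopular [y] carry at most half of the [a * a] pairs, so [a <= 2 * v] and
   [u <= q * a <= 2 * q * v], against [Xsmall]. *)
move=> eqs.
have u2 : (u * u <= (q * a) * (q * a))%N by rewrite leq_mul.
have s'le : (2 * q ^ 2 * s' <= q ^ 2 * (a * a))%N by rewrite -mulnn; nia.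
have q0 : (0 < q)%N by case: (q) Ubig Xsmall => //; lia.
have s'le' : (2 * s' <= a * a)%N.
  by rewrite -(leq_pmul2l (m := q ^ 2)) ?expn_gt0 ?q0 //; nia.
have aav : (a * a <= 2 * v * a)%N by nia.
have a0 : (0 < a)%N by case: (a) Ubig Xsmall => //; nia.
have : (a <= 2 * v)%N by rewrite -(leq_pmul2r a0).
nia.
Qed.

End BinarySpace.

(** Induction on [t]: for a popular difference [y] outside [X], apply the induction hypothesis to
    [self_overlap A y] and add [y] to the directions found. Avoiding [X + <[y]>] keeps [y]
    independent of them. *)
Lemma affine_subspace t q s : exists d0, forall n (A : {set 'rV['F_2]_n})
    (U X : {vspace 'rV['F_2]_n}),
    (d0 <= \dim U)%N -> {subset A <= U} -> (#|U| <= q * #|A|)%N -> (#|X| <= s)%N ->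
  exists a (U' : {vspace 'rV['F_2]_n}),
    [/\ (U' <= U)%VS, (U' :&: X = 0)%VS, \dim U' = t, a \in U
      & forall u, u \in U' -> a + u \in A].
Proof.
elim: t q s => [|t IH] q s.
  exists 0%N => n A U X _ AU Ubig _.
  have /card_gt0P[a aA] : (0 < #|A|)%N.
    case: #|A| Ubig => //; rewrite muln0 leqn0 card_vspaceF2 expn_eq0 //.
  exists a, 0%VS; split; rewrite ?sub0v ?cap0v ?dimv0 ?AU // => u.
  by rewrite memv0 => /eqP->; rewrite addr0.
have [d0 Hd0] := IH (2 * q ^ 2)%N (2 * s)%N.
(* Since [d < 2 ^ d], the second bound forces [2 * q * #|X| < #|U|]. *)
exists (maxn d0 (2 * q * s)) => n A U X; rewrite geq_max => /andP[d0U sU] AU Ubig Xs.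
have [|y [yU yX popy]] := popular_difference (X := X) AU Ubig.
  apply: leq_ltn_trans (leq_mul (leqnn _) Xs) _.
  by rewrite card_vspaceF2; apply: leq_ltn_trans sU (ltn_expl _ _).
have popAU : {subset self_overlap A y <= U} by move=> x; rewrite inE => /andP[/AU].
have [|a [U' [U'U U'X dU' aU aA]]] := Hd0 _ _ U (X + <[y]>)%VS d0U popAU popy.
  by apply: leq_trans (card_vspace_add_line _ _) _; rewrite leq_mul.
have y0 : y != 0 by apply: contraNneq yX => ->; rewrite mem0v.
have U'y : (U' :&: <[y]> = 0)%VS.
  by apply/eqP; rewrite -subv0 -U'X capvS // addvSr.
exists a, (U' + <[y]>)%VS; split=> //.
- by rewrite subv_add U'U -memvE.
- apply/eqP; rewrite -subv0; apply/subvP => x /memv_capP[/memv_addP[u uU' [v]]].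
  case/vlineP=> c -> ->; rewrite scaleF2; case: ifP => _ xX.
    move: xX; rewrite addr0 => xX; rewrite -U'X; apply/memv_capP; split=> //.
    by apply: subvP xX; rewrite addvSl.
  have : u \in (U' :&: (X + <[y]>))%VS.
    apply/memv_capP; split=> //; rewrite -(addK2 y u).
    by rewrite memv_add ?memv_line.
  rewrite U'X memv0 => /eqP u0; move: xX; rewrite u0 add0r => yX'.
  by rewrite yX' in yX.
- by rewrite dimv_disjoint_sum // dU' dim_vline y0 addn1.
- move=> u /memv_addP[v vU' [w /vlineP[c ->] ->]]; have := aA _ vU'.
  rewrite inE addrA scaleF2 => /andP[? ?].
  by case: ifP; rewrite ?addr0.
Qed.

(** * Blow-ups, coset counts and small doubling *)

Section Blowup.
Variable n : nat.
Notation V := 'rV['F_2]_n.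
Implicit Types (x y z p h : V) (A B D M S : {set V}) (U X L : {vspace V}).

(* As soon as [0 \notin M], this forces [X :&: U = 0], and then [M] contains the
   Bose-Burton geometry [(X + U) :\: U]. *)
Definition blowup M X U :=
  forall x u, x \in X -> x != 0 -> u \in U -> x + u \in M.

(** This is the union of the cosets of [X] contained in [M], so its size compares directly with
    [2 ^ n]. *)
Definition cosets_in M X := [set h | [forall x in X, h + x \in M]].

Lemma cosets_inP M X h :
  reflect (forall x, x \in X -> h + x \in M) (h \in cosets_in M X).
Proof. by rewrite inE; apply: forall_inP. Qed.

Lemma cosets_inPn M X h :
  reflect (exists2 x, x \in X & h + x \notin M) (h \notin cosets_in M X).
Proof. by rewrite inE; apply: forall_inPn. Qed.

Lemma card_sum_mem A : #|A| = (\sum_z (z \in A))%N.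
Proof. by rewrite -sum1_card big_mkcond; apply: eq_bigr => z _; case: (z \in A). Qed.

Lemma expn_sum1 : (2 ^ n = \sum_(z : V) 1)%N.
Proof. by rewrite sum1_card card_rVF2. Qed.

Lemma sum_card_translate A U :
  (\sum_h #|[set u in U | (h + u \in A)%R]| = #|U| * #|A|)%N.
Proof.
have -> : (\sum_h #|[set u in U | (h + u \in A)%R]|
           = \sum_h \sum_(u in U) (h + u \in A)%R)%N.
  apply: eq_bigr => h _; rewrite -sum1_card big_mkcond /= [RHS]big_mkcond /=.
  by apply: eq_bigr => u _; rewrite !inE; case: (u \in U); case: (h + u \in A).
rewrite exchange_big /= -sum_nat_const; apply: eq_bigr => u _.
rewrite (reindex_inj (inv_inj (addK2 u))) /= -sum1_card [RHS]big_mkcond /=.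
by apply: eq_bigr => h _; rewrite addK2; case: (h \in A).
Qed.

Lemma dense_translate q A U : (2 ^ n <= q * #|A|)%N ->
  exists h, (#|U| <= q * #|[set u in U | (h + u \in A)%R]|)%N.
Proof.
move=> Abig.
suff: [exists h, #|U| <= q * #|[set u in U | (h + u \in A)%R]|]%N.
  by case/existsP=> h ?; exists h.
apply: contraT; rewrite negb_exists => /forallP noh.
have : (\sum_h (q * #|[set u in U | (h + u \in A)%R]|).+1 <= 2 ^ n * #|U|)%N.
  rewrite -card_rVF2 -sum_nat_const; apply: leq_sum => h _.
  by have := noh h; rewrite -ltnNge.
under eq_bigr do rewrite -addn1.
rewrite big_split /= -big_distrr /= sum_card_translate sum_nat_const muln1.
rewrite !card_rVF2 => le1; have := leq_mul Abig (leqnn #|U|).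
have := expn_gt0 2 n; rewrite /= -mulnA [(#|A| * _)%N]mulnC.
by move: le1; rewrite !card_vspaceF2; lia.
Qed.

(** Count pairs of an [h] and a point of [h + X] outside [M]: there are [#|X| * #|~: M|]. Each [h]
    outside [cosets_in M X] gives at least one, and at least two if it is in the overlap. *)
Lemma self_overlap_cosets_in M X p : p \in X -> p != 0 ->
  (#|self_overlap (~: M) p| + 2 ^ n <= #|X| * #|~: M| + #|cosets_in M X|)%N.
Proof.
move=> pX p0; rewrite -sum_card_translate.
rewrite [#|self_overlap _ _|]card_sum_mem [#|cosets_in _ _|]card_sum_mem expn_sum1.
rewrite -!big_split /=; apply: leq_sum => h _.
have [hX|/cosets_inPn[x xX hx]] := boolP (h \in cosets_in M X).
  suff -> : (h \in self_overlap (~: M) p) = false by rewrite leq_addl.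
  by move/cosets_inP: hX => /(_ p pX) hp; rewrite !inE hp andbF.
rewrite addn0; case: (boolP (h \in self_overlap _ _)) => [|_].
  rewrite !inE => /andP[hM hpM]; rewrite addn1.
  apply: leq_trans (subset_leq_card (A := [set 0; p]) _); first by rewrite cards2 eq_sym p0.
  by apply/subsetP=> y; rewrite !inE => /orP[]/eqP->; rewrite ?mem0v ?addr0 ?pX ?hM ?hpM.
by rewrite add0n card_gt0; apply/set0Pn; exists x; rewrite !inE xX.
Qed.

Lemma card_cosets_in M X : (2 ^ n <= #|X| * #|~: M| + #|cosets_in M X|)%N.
Proof.
rewrite -sum_card_translate [#|cosets_in _ _|]card_sum_mem expn_sum1.
rewrite -!big_split /=; apply: leq_sum => h _.
have [hX|/cosets_inPn[x xX hx]] := boolP (h \in cosets_in M X); first by rewrite leq_addl.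
by rewrite addn0 card_gt0; apply/set0Pn; exists x; rewrite !inE xX.
Qed.

(** A nonzero element of [X + <[h]>] is either a nonzero [x], covered by the old blow-up, or
    [x + h], covered by the cosets [h + u + X]. *)
Lemma blowup_add_line M X U U' h : 0 \notin M -> blowup M X U -> (U' <= U)%VS ->
    (forall u, u \in U' -> h + u \in cosets_in M X) ->
  \dim (X + <[h]>) = (\dim X).+1 /\ blowup M (X + <[h]>)%VS U'.
Proof.
move=> M0 MXU U'U hU'.
have hX : h \notin X.
  apply: contra M0 => hX; have /cosets_inP/(_ h hX) := hU' 0 (mem0v _).
  by rewrite addr0 addrr2.
have h0 : h != 0 by apply: contraNneq hX => ->; rewrite mem0v.
split.
  rewrite dimv_disjoint_sum ?dim_vline ?h0 ?addn1 //.
  apply/eqP; rewrite -subv0; apply/subvP => x /memv_capP[xX /vlineP[c xE]].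
  move: xE xX; rewrite scaleF2; case: ifP => _ ->; first by rewrite !mem0v.
  by rewrite (negbTE hX).
move=> _ u /memv_addP[x xX [_ /vlineP[c ->] ->]] xh0 uU'.
move: xh0; rewrite scaleF2; case: ifP => _; rewrite ?addr0 => xh0.
  by apply: MXU => //; apply: subvP uU'.
by have /cosets_inP/(_ x xX) := hU' u uU'; rewrite addrC addrA.
Qed.

(** Both overlaps lie in [A], and translation by [z] takes their intersection into the overlap for
    [z + w]. *)
Lemma self_overlapD A z w :
  (#|self_overlap A z| + #|self_overlap A w| <= #|A| + #|self_overlap A (z + w)|)%N.
Proof.
rewrite -cardsUI; apply: leq_add.
  by apply/subset_leq_card/subsetP=> x; rewrite !inE => /orP[]/andP[].
rewrite -(card_imset _ (inv_inj (addK2 z))).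
apply/subset_leq_card/subsetP=> _ /imsetP[x + ->].
rewrite !inE => /andP[/andP[xA xz] /andP[_ xw]].
by rewrite xz addrA addK2.
Qed.

Definition sumset A : {set V} := [set x + y | x in A, y in A].

Lemma sumsetP A z : reflect (exists x y : V, [/\ x \in A, y \in A & z = x + y])
  (z \in sumset A).
Proof.
apply: (iffP imset2P) => [[x y xA yA ->]|[x [y [xA yA ->]]]]; last by exists x y.
by exists x, y.
Qed.

(** The sumset contains [A + a] and [A + b], whose intersection, translated by [a], lies in the
    overlap for [a + b]. *)
Lemma card_self_overlap_sumset A a b : a \in A -> b \in A ->
  (2 * #|A| <= #|sumset A| + #|self_overlap A (a + b)|)%N.
Proof.
move=> aA bA.
rewrite mul2n -addnn -{1}(card_imset A (inv_inj (addK2 a))).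
rewrite -(card_imset A (inv_inj (addK2 b))) -cardsUI; apply: leq_add.
  apply/subset_leq_card/subsetP=> y /setUP[]/imsetP[x xA ->]; apply/sumsetP.
    by exists x, a.
  by exists x, b.
rewrite -[leqLHS](card_imset _ (inv_inj (addK2 a))).
apply/subset_leq_card/subsetP=> _ /imsetP[y /setIP[/imsetP[x xA yx] /imsetP[x' xA' yx']] ->].
by rewrite inE {1}yx addK2 xA addrA addK2 yx' addK2.
Qed.

(** Freiman's 3/2 theorem: each element of the sumset has an overlap larger than half of [A], so a
    sum of two of them has a nonempty one. *)
Lemma small_doubling A : (2 * #|sumset A| < 3 * #|A|)%N ->
  {in sumset A &, forall x y, x + y \in sumset A}.
Proof.
move=> Ssmall z w /sumsetP[a [b [aA bA ->]]] /sumsetP[c [d [cA dA ->]]].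
have h1 := card_self_overlap_sumset aA bA; have h2 := card_self_overlap_sumset cA dA.
have h3 := self_overlapD A (a + b) (c + d).
have /card_gt0P[x] : (0 < #|self_overlap A (a + b + (c + d))|)%N.
  move: h1 h2 h3 Ssmall; move: #|sumset A| #|self_overlap A (a + b)| #|self_overlap A (c + d)|.
  by move: #|self_overlap A _| #|A|; lia.
rewrite inE => /andP[xA xA']; apply/sumsetP; exists x, (x + (a + b + (c + d))).
by split=> //; rewrite [RHS]addrC [x + _]addrC addK2.
Qed.

End Blowup.

(** * Growing blow-ups one dimension at a time *)

Lemma blowup_extend t q : exists d0, forall n (M : {set 'rV['F_2]_n})
    (X U : {vspace 'rV['F_2]_n}), 0 \notin M -> blowup M X U ->
    (d0 <= \dim U)%N -> (2 ^ n <= q * #|cosets_in M X|)%N ->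
  exists X' U' : {vspace 'rV['F_2]_n},
    [/\ (X <= X')%VS, \dim X' = (\dim X).+1, \dim U' = t & blowup M X' U'].
Proof.
have [d0 Hd0] := affine_subspace t q 1.
exists d0 => n M X U M0 MXU d0U Xbig.
(* Some [h + U] is rich in [cosets_in M X]; an affine subspace [h + a + U'] found there supplies the
   new direction [h + a]. *)
have [h hbig] := dense_translate U Xbig.
set A := [set u in U | _] in hbig.
have AU : {subset A <= U} by move=> u; rewrite inE => /andP[].
have [|a [U' [U'U _ dU' aU aA]]] := Hd0 _ A U 0%VS d0U AU hbig.
  by rewrite card_vspaceF2 dimv0.
have [u uU'|dX' MX'U'] := blowup_add_line (h := h + a) M0 MXU U'U.
  by have := aA u uU'; rewrite !inE addrA => /andP[].
by exists (X + <[h + a]>)%VS, U'; rewrite addvSl.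
Qed.

(** Before each extension [#|X|] is at most half its final value, so
    [4 * #|X| * #|~: M| <= 3 * 2 ^ n] and a quarter of the translates of [X] lie in [M]. *)
Lemma blowup_extend_iter j t : exists d0, forall n (M : {set 'rV['F_2]_n})
    (X U : {vspace 'rV['F_2]_n}), 0 \notin M -> blowup M X U ->
    (d0 <= \dim U)%N ->
    (2 * 2 ^ (\dim X + j) * #|~: M| <= 3 * 2 ^ n)%N ->
  exists X' U' : {vspace 'rV['F_2]_n},
    [/\ (X <= X')%VS, \dim X' = (\dim X + j)%N, (t <= \dim U')%N & blowup M X' U'].
Proof.
elim: j => [|j [d1 Hd1]].
  by exists t => n M X U _ MXU tU _; exists X, U; rewrite addn0.
have [d0 Hd0] := blowup_extend d1 4.
exists d0 => n M X U M0 MXU d0U Dsmall.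
have [|X1 [U1 [XX1 dX1 dU1 MX1]]] := Hd0 n M X U M0 MXU d0U.
  have := card_cosets_in M X; rewrite card_vspaceF2.
  have : (2 ^ \dim X * 2 <= 2 ^ (\dim X + j.+1))%N.
    by rewrite mulnC -expnS leq_exp2l // addnS ltnS leq_addr.
  by move: Dsmall; move: (2 ^ (_ + _))%N => e; nia.
have [||X2 [U2 [XX2 dX2 dU2 MX2]]] := Hd1 n M X1 U1 M0 MX1.
- by rewrite dU1.
- by rewrite dX1 addSnnS.
exists X2, U2; split=> //; first exact: subv_trans XX2.
by rewrite dX2 dX1 addSnnS.
Qed.

(** If the set [E] of points without such an [X] were dense, it would contain some [p + U]. Then [M]
    blows up [<[p]>], hence an [X] of dimension [c] through [p]; as this cannot be extended, few of
    its translates lie in [M], a contradiction. *)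
Lemma few_exceptional_points c t q : exists r0, forall n (M : {set 'rV['F_2]_n}),
    (r0 <= n)%N -> 0 \notin M ->
    (2 * 2 ^ c * #|~: M| <= 3 * 2 ^ n)%N ->
    (forall X U, \dim X = c.+1 -> \dim U = t -> ~ blowup M X U) ->
  exists E : {set 'rV['F_2]_n}, [/\ E \subset M, (q * #|E| <= 2 ^ n)%N
    & forall p, p \in M -> p \notin E -> exists X : {vspace 'rV['F_2]_n},
        [/\ p \in X, \dim X = c & (q * #|cosets_in M X| <= 2 ^ n)%N]].
Proof.
have [d1 Hd1] := blowup_extend t q.
(* From the line [<[p]>], [c.-1] extensions reach dimension [c]. If [c = 0], the line itself has the
   forbidden dimension [c.+1]. *)
have [d2 Hd2] := blowup_extend_iter c.-1 d1.
have [r0 Hr0] := affine_subspace (if c is 0 then t else d2) q 1.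
exists r0 => n M r0n M0 Dsmall noblow.
pose good p := exists X : {vspace 'rV['F_2]_n},
        [/\ p \in X, \dim X = c & (q * #|cosets_in M X| <= 2 ^ n)%N].
exists [set p in M | `[< ~ good p >]]; split.
- by apply/subsetP=> p; rewrite inE => /andP[].
- set E := [set p in M | _]; rewrite leqNgt; apply/negP => Ebig.
  have [||||p [U [_ _ dU _ pU]]] := Hr0 n E fullv 0%VS.
  + by rewrite dim_rVF2.
  + by move=> x _; rewrite memvf.
  + by rewrite card_vspaceF2 dim_rVF2 ltnW.
  + by rewrite card_vspaceF2 dimv0.
  have pE : p \in E by rewrite -[p]addr0 pU ?mem0v.
  have MpU : blowup M <[p]> U.
    move=> _ u /vlineP[a ->]; rewrite scaleF2; case: ifP; rewrite ?eqxx // => _ _ /pU.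
    by rewrite inE => /andP[].
  have dp : \dim <[p]> = 1%N.
    rewrite dim_vline; suff -> : p != 0 by [].
    by apply: contraNneq M0 => <-; move: pE; rewrite inE => /andP[].
  case: c => [|c] in Hd2 Dsmall noblow good E Hr0 Ebig dU pU pE *.
    exact: (noblow _ U dp dU).
  have [||X [U' [pX dX dU' MXU']]] := Hd2 n M <[p]>%VS U M0 MpU.
  + by rewrite dU.
  + by rewrite dp.
  move: pE; rewrite inE => /andP[_ /asboolP]; apply.
  exists X; split; rewrite ?dX ?dp // ?memvE //.
  rewrite leqNgt; apply/negP => Xbig.
  have [X' [U'' [_ dX' dU'' MX']]] := Hd1 n M X U' M0 MXU' dU' (ltnW Xbig).
  by apply: noblow dU'' MX'; rewrite dX' dX dp.
- by move=> p pM; rewrite inE pM /= => /asboolPn/contrapT.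
Qed.

(** * Stability of sets almost closed under addition *)

Section Stability.
Variables (R : realFieldType) (n c : nat).
Notation V := 'rV['F_2]_n.
Variables (D E : {set V}) (b e : R).
Let g : R := 2 ^+ n.
Hypotheses (cn : (c <= n)%N) (bE : b * 2 ^+ c = 1) (e_gt0 : 0 < e)
  (eb : 100 * e <= b).
Hypotheses (D0 : 0 \in D) (Dle : #|D|%:R <= (b + e) * g)
  (Dge : (b - e) * g <= #|D|%:R) (Ele : #|E|%:R <= e ^+ 2 * g).
Hypothesis Dpop : forall p, p \notin D -> p \notin E ->
  #|self_overlap D p|%:R <= e ^+ 2 * g.

Let D1 := [set z in D | #|D|%:R <= #|self_overlap D z|%:R + e * g].

Let g_gt0 : 0 < g.
Proof. by rewrite exprn_gt0 ?ltr0n. Qed.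

Let b_le1 : b <= 1.
Proof.
have b0 : 0 <= b by have := e_gt0; have := eb; lra.
by rewrite -bE ler_peMr // exprn_ege1 // ler1n.
Qed.

Let e2g : e ^+ 2 * g <= e * g.
Proof. by rewrite ler_pM2r // expr2 ler_piMr ?ltW //; move: b_le1 e_gt0 eb; lra. Qed.

Let sum_ind (A : {set V}) (a : R) : \sum_z (z \in A)%:R * a = #|A|%:R * a.
Proof.
rewrite -big_distrl /= -natr_sum; congr (_%:R * _).
by rewrite card_sum_mem.
Qed.

(** The overlaps sum to [#|D|] squared. Elements of [D :\: D1] fall short of [#|D|] by [e * g];
    those outside [D] add at most [e ^+ 2 * g] each, or [g] on [E]. *)
Let card_DD1 : #|D :\: D1|%:R <= 2 * e * g.
Proof.
have le_g (A : {set V}) : #|A|%:R <= g by rewrite /g -natrX ler_nat -card_rVF2 max_card.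
have sumE : \sum_z #|self_overlap D z|%:R = #|D|%:R * #|D|%:R :> R.
  rewrite -natrM -(@sum_self_overlap _ D fullv); last by move=> x _; rewrite memvf.
  by rewrite natr_sum; apply: eq_bigl => z; rewrite memvf.
have : \sum_z #|self_overlap D z|%:R <= \sum_z ((z \in D)%:R * #|D|%:R
    - (z \in D :\: D1)%:R * (e * g) + (z \in [set: V])%:R * (e ^+ 2 * g)
    + (z \in E)%:R * g) :> R.
  apply: ler_sum => z _; rewrite in_setT mul1r.
  have e2g0 : 0 <= e ^+ 2 * g by rewrite mulr_ge0 ?sqr_ge0 ?ltW.
  have Eg0 : 0 <= (z \in E)%:R * g by rewrite mulr_ge0 ?ler0n ?ltW.
  have [zD|zD] := boolP (z \in D).
    have := card_self_overlap D z; rewrite -(ler_nat R) => popz.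
    have [zD1|] := boolP (z \in D1).
      by rewrite in_setD zD1 /= mul1r mul0r; lra.
    by rewrite in_setD => zD1; rewrite zD1 zD !mul1r; move: zD1; rewrite inE zD /= -ltNge; lra.
  rewrite in_setD (negbTE zD) andbF !mul0r.
  have [zE|zE] := boolP (z \in E); last by rewrite mul0r; have := Dpop zD zE; lra.
  by rewrite mul1r; have := le_g (self_overlap D z); lra.
rewrite sumE !big_split /= sumrN !sum_ind cardsT card_rVF2 natrX -/g.
have := ler_wpM2r (ltW g_gt0) Ele => Eg sumle; rewrite -(ler_pM2r (_ : 0 < e * g)) ?mulr_gt0 //.
have -> : 2 * e * g * (e * g) = e ^+ 2 * g * g + g * (e ^+ 2 * g) by ring.
by move: Eg sumle; lra.
Qed.

Let S := sumset D1.

(** A sum of two elements of [D1] has overlap at least [#|D| - 2 * e * g], too large outside [D] and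
    [E]. *)
Let S_sub x : x \in S -> x \in D :|: E.
Proof.
case/sumsetP=> z [w []]; rewrite !inE => /andP[zD zp] /andP[wD wp] ->.
have := self_overlapD D z w; rewrite -(ler_nat R) !natrD => pD.
have [//|zwD] := boolP (z + w \in D); have [//|zwE] := boolP (z + w \in E).
have := Dpop zwD zwE; have : 0 < e * g by rewrite mulr_gt0.
have : 100 * (e * g) <= b * g by rewrite mulrA ler_pM2r.
by move: Dge e2g; rewrite mulrBl; lra.
Qed.

(* [D1] collects the [z] in [D] whose translate almost preserves [D]; averaging
   shows that it is most of [D], and its sumset [S] is confined to [D :|: E].
   Hence [D1] has doubling less than 3/2 and [S] is a subspace. *)
Lemma nearly_closed_stability : exists L : {vspace V},
  [/\ (\dim L + c = n)%N, #|[set x in D | x \notin L]|%:R <= 2 * e * g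
    & #|[set x in L | x \notin D]|%:R <= e * g].
Proof.
have eg : 0 < e * g by rewrite mulr_gt0.
have ebg : 100 * (e * g) <= b * g by rewrite mulrA ler_pM2r.
have D1D : D1 \subset D by apply/subsetP=> z; rewrite inE => /andP[].
have D10 : 0 \in D1.
  rewrite inE D0 (_ : self_overlap D 0 = D) ?lerDl ?ltW //.
  by apply/setP=> x; rewrite inE addr0 andbb.
have D1S : D1 \subset S.
  by apply/subsetP=> x xD1; apply/sumsetP; exists x, 0; rewrite addr0.
have cardD1 : #|D|%:R = #|D1|%:R + #|D :\: D1|%:R :> R.
  by rewrite -natrD -(cardsID D1 D) (setIidPr D1D).
have cardS : #|S|%:R <= #|D|%:R + #|E|%:R :> R.
  rewrite -natrD ler_nat (leq_trans _ (leq_card_setU D E)) //.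
  by apply/subset_leq_card/subsetP => x /S_sub.
have cD := card_DD1; have e2 := e2g.
have Sdbl : (2 * #|S| < 3 * #|D1|)%N.
  rewrite -(ltr_nat R) !natrM; move: cD Dge Dle Ele; rewrite mulrBl mulrDl; lra.
have [L LS] := vspace_of_addclosed (subsetP D1S _ D10) (small_doubling Sdbl).
have bg : b * g = (2 ^ (n - c))%:R.
  by rewrite /g -{1}(subnK cn) exprD mulrCA bE mulr1 natrX.
have cardL : #|L| = #|S| by apply: eq_card.
exists L; split.
(* [#|L|] is a power of 2 and differs from [2 ^ (n - c)] by a factor less than 2. *)
- suff : (\dim L == n - c)%N by move/eqP->; rewrite subnK.
  rewrite eqn_leq -ltnS -(@ltn_exp2l 2) // -[X in _ && X]ltnS.
  rewrite -(@ltn_exp2l 2 _ (\dim L).+1) // !expnS -card_vspaceF2 cardL.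
  rewrite -!(ltr_nat R) !natrM -bg.
  have : #|D1|%:R <= #|S|%:R :> R by rewrite ler_nat subset_leq_card.
  by move: cD Dge Dle Ele; rewrite mulrBl mulrDl; lra.
- apply: le_trans cD; rewrite ler_nat; apply/subset_leq_card/subsetP => x.
  rewrite inE => /andP[xD]; rewrite LS in_setD xD andbT.
  by apply: contra => /(subsetP D1S).
- apply: le_trans e2; apply: le_trans Ele; rewrite ler_nat.
  apply/subset_leq_card/subsetP => x; rewrite inE LS => /andP[/S_sub].
  by rewrite inE => /orP[->|].
Qed.

End Stability.

Lemma blowup_free_stability (R : archiRealFieldType) (c t : nat) (eps : R) :
    0 < eps ->
  exists (delta : R) (r0 : nat), [/\ 0 < delta, (0 < r0)%N &
    forall n (M : {set 'rV['F_2]_n}), (r0 <= n)%N -> 0 \notin M ->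
      (forall X U, \dim X = c.+1 -> \dim U = t -> ~ blowup M X U) ->
      #|~: M|%:R <= ((2 ^+ c)^-1 + delta) * 2 ^+ n ->
      exists L : {vspace 'rV['F_2]_n}, (\dim L + c)%N = n /\
        #|symdiff M [set x | x \notin L]|%:R < eps * 2 ^+ n].
Proof.
move=> eps_gt0; pose C : R := 2 ^+ c; pose b := C^-1.
have C_gt0 : 0 < C by rewrite exprn_gt0.
have b_gt0 : 0 < b by rewrite invr_gt0.
have bC : b * C = 1 by rewrite mulVf ?gt_eqF.
have b_le1 : b <= 1 by rewrite invf_le1 // exprn_ege1 ?ler1n.
(* The bound [b / 100] serves the doubling estimate; [eps / 4] leaves room for the final error
   [3 * e * g]. *)
pose e := Num.min (b / 100) (eps / 4).
have e_gt0 : 0 < e by rewrite lt_min !divr_gt0.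
have eb : 100 * e <= b.
  by have : e <= b / 100; [rewrite ge_min lexx | lra].
have e_eps : 4 * e <= eps.
  by have : e <= eps / 4; [rewrite ge_min lexx orbT | lra].
have e2_gt0 : 0 < e ^+ 2 by rewrite exprn_gt0.
have e2_le : e ^+ 2 <= e by rewrite expr2 ler_piMr ?ltW //; lra.
(* With this [q], coset counts contribute at most [e ^+ 2 / 2 * g] to the overlaps; [delta]
   contributes the other half. *)
pose q := Num.bound (2 / e ^+ 2).
have q_gt : 2 <= q%:R * e ^+ 2.
  rewrite -ler_pdivrMr //; apply/ltW/archi_boundP.
  by rewrite divr_ge0 ?ltW.
have [r0 Hr0] := few_exceptional_points c t q.
exists (e ^+ 2 * b / 2), (maxn r0 c.+1); split.
- by rewrite divr_gt0 ?mulr_gt0.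
- by rewrite leq_max orbT.
move=> n M; rewrite geq_max => /andP[r0n cn] M0 noblow; rewrite -/C -/b.
set D := ~: M => Dle0; set g : R := 2 ^+ n in Dle0 *.
have g_gt0 : 0 < g by rewrite exprn_gt0.
have gE : g = (2 ^ n)%:R by rewrite natrX.
have CD : C * #|D|%:R <= g + e ^+ 2 / 2 * g.
  have := ler_wpM2l (ltW C_gt0) Dle0.
  have -> : C * ((b + e ^+ 2 * b / 2) * g) = b * C * (g + e ^+ 2 / 2 * g) by field.
  by rewrite bC mul1r.
have e2g : e ^+ 2 * g <= e * g by rewrite ler_pM2r.
have small k : (q * k <= 2 ^ n)%N -> k%:R <= e ^+ 2 / 2 * g.
  rewrite -(ler_nat R) natrM -gE => qk.
  have := ler_wpM2r (ltW e2_gt0) qk.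
  have := ler_wpM2r (ler0n R k) q_gt.
  lra.
have [|E [EM Esmall Egood]] := Hr0 n M r0n M0 _ noblow.
  rewrite -(ler_nat R) !natrM natrX -/C -gE -mulrA -/D.
  have : e * g <= g by rewrite ler_piMl ?ltW //; lra.
  lra.
have cM : #|M|%:R + #|D|%:R = g.
  by rewrite -natrD cardsC gE card_rVF2.
have X_D (X : {vspace 'rV['F_2]_n}) : \dim X = c ->
    (#|X| * #|D|)%:R = C * #|D|%:R :> R.
  by move=> dX; rewrite natrM card_vspaceF2 dX natrX.
have := small _ Esmall => Ele.
have e2g_gt0 : 0 < e ^+ 2 * g by rewrite mulr_gt0.
have bge : 100 * (e * g) <= b * g by rewrite mulrA ler_pM2r.
have bg1 : b * g <= g by rewrite ler_piMl // ltW.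
have [||||p pD pE|L [dL DL LD]] :=
    @nearly_closed_stability R n c D E b e (ltnW cn) bC e_gt0 eb.
- by rewrite inE.
- apply: le_trans Dle0 _; rewrite ler_pM2r // lerD2l.
  have : e ^+ 2 * b <= e ^+ 2 by rewrite ler_piMr // ltW.
  lra.
(* Lower bound on [D]: either [M] is tiny, or almost all translates of the [X] of one good point
   meet [D]. *)
- have [ME|/subsetPn[p pM pE]] := boolP (M \subset E).
    have : #|M|%:R <= #|E|%:R :> R by rewrite ler_nat subset_leq_card.
    by rewrite -/g mulrBl; lra.
  have [X [_ dX /small Xsmall]] := Egood p pM pE.
  have := card_cosets_in M X; rewrite -(ler_nat R) natrD X_D // -gE => le1.
  have : b * (C * #|D|%:R) = #|D|%:R by rewrite mulrA bC mul1r.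
  have : b * g <= b * (C * #|D|%:R + e ^+ 2 / 2 * g) by rewrite ler_pM2l //; lra.
  have : b * (e ^+ 2 / 2 * g) <= e ^+ 2 / 2 * g.
    by rewrite ler_piMl // mulr_ge0 ?divr_ge0 ?ltW.
  rewrite mulrDr mulrBl -/g; lra.
- by rewrite -/g; lra.
- have pM : p \in M by move: pD; rewrite inE negbK.
  have [X [pX dX /small Xsmall]] := Egood p pM pE.
  have p0 : p != 0 by apply: contraNneq M0 => <-.
  have := self_overlap_cosets_in M pX p0; rewrite -(ler_nat R) !natrD X_D // -gE.
  by rewrite -/D -/g; lra.
exists L; split=> //.
apply: (@le_lt_trans _ _ (#|[set x in L | x \notin D]|%:R + #|[set x in D | x \notin L]|%:R)).
  rewrite -natrD ler_nat (leq_trans _ (leq_card_setU _ _)) //.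
  apply/subset_leq_card/subsetP => x.
  by rewrite !inE !negbK => /orP[/andP[-> ->]|/andP[-> ->]]; rewrite ?orbT.
have : 4 * (e * g) <= eps * g by rewrite mulrA ler_pM2r.
have : 0 < e * g by rewrite mulr_gt0.
by move: DL LD; rewrite -/g; lra.
Qed.

(** * Embedding [N] into a blow-up *)

Lemma vspace_iso (F : fieldType) (vT wT : vectType F) (A : {vspace vT})
    (B : {vspace wT}) : \dim A = \dim B ->
  exists f : 'Hom(vT, wT), [/\ forall v, f v \in B,
    {in A, forall v, f v = 0 -> v = 0} & {in B, forall w, exists v, f v = w}].
Proof.
move=> dAB; pose X := tcast (esym dAB) (vbasis B).
have Xb : basis_of B X by rewrite val_tcast vbasisP.
pose f (v : vT) : wT := \sum_(i < \dim A) coord (vbasis A) i v *: X`_i.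
have fl : linear f.
  move=> a u v; rewrite /f scaler_sumr -big_split /=; apply: eq_bigr => i _.
  by rewrite linearP scalerDl scalerA.
pose fL := GRing.isLinear.Build F vT wT _ f fl.
pose f' : {linear vT -> wT} := HB.pack f fL.
exists (linfun f'); split=> [v|v vA|w wB].
- rewrite lfunE /=; apply: rpred_sum => i _; apply/rpredZ.
  by rewrite (basis_mem Xb) // mem_nth ?size_tuple.
- rewrite lfunE /= => fv0; rewrite (coord_vbasis vA) big1 // => i _.
  rewrite -(coord_sum_free (fun j => coord (vbasis A) j v) i (basis_free Xb)).
  by rewrite -/(f v) fv0 linear0 scale0r.
exists (\sum_(i < \dim A) coord X i w *: (vbasis A)`_i).
rewrite lfunE /= [RHS](coord_basis Xb wB); apply: eq_bigr => i _.
by rewrite coord_sum_free // (basis_free (vbasisP A)).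
Qed.

(** Map [W] to [U] and a complement of [W] to [X]. The last clause gives vectors outside [W] a
    nonzero component in [X], as a blow-up requires. *)
Lemma vspace_sum_iso (F : fieldType) (vT wT : vectType F) (W : {vspace vT})
    (X U : {vspace wT}) :
    (X :&: U = 0)%VS -> \dim W = \dim U -> \dim W^C = \dim X ->
  exists2 f : 'Hom(vT, wT), injective f & forall v, exists x u,
    [/\ x \in X, u \in U, f v = x + u & x = 0 -> v \in W].
Proof.
move=> XU0 dW dWC.
have [f1 [f1U f1_inj _]] := vspace_iso dW.
have [f2 [f2X f2_inj _]] := vspace_iso dWC.
pose p1 := daddv_pi W W^C; pose p2 := daddv_pi W^C W.
have p12 v : p1 v + p2 v = v by rewrite daddv_pi_add ?capv_compl // addv_complf memvf.
have p1W v : p1 v \in W by rewrite memv_pi.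
have p2W v : p2 v \in (W^C)%VS by rewrite memv_pi.
pose f := (f1 \o p1)%VF + (f2 \o p2)%VF.
have fE v : f v = f2 (p2 v) + f1 (p1 v) by rewrite /f add_lfunE !comp_lfunE addrC.
exists f => [|v].
  apply/lker0P; rewrite -subv0; apply/subvP=> v; rewrite memv_ker fE.
  rewrite addr_eq0 => /eqP f21.
  have f20 : f2 (p2 v) = 0.
    by apply/eqP; rewrite -memv0 -XU0 memv_cap f2X f21 rpredN f1U.
  have f10 : f1 (p1 v) = 0 by apply/eqP; rewrite -oppr_eq0 -f21 f20.
  by rewrite memv0 -[v]p12 (f1_inj _ (p1W v)) // (f2_inj _ (p2W v)) // addr0.
exists (f2 (p2 v)), (f1 (p1 v)); split=> // /(f2_inj _ (p2W v)) p2v0.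
by rewrite -[v]p12 p2v0 addr0.
Qed.

Lemma blowup_embedding k n (N : {set 'rV['F_2]_k}) (W : {vspace 'rV['F_2]_k})
    (M : {set 'rV['F_2]_n}) (X U : {vspace 'rV['F_2]_n}) :
    0 \notin M -> blowup M X U -> (forall x, x \in N -> x \notin W) ->
    \dim W = \dim U -> (k - \dim W)%N = \dim X ->
  exists2 f : 'Hom('rV['F_2]_k, 'rV['F_2]_n), injective f
    & forall x, x \in N -> f x \in M.
Proof.
move=> M0 MXU NW dW dX.
have XU0 : (X :&: U = 0)%VS.
  apply/eqP; rewrite -subv0; apply/subvP=> x /memv_capP[xX xU]; rewrite memv0.
  by apply: contraNT M0 => x0; rewrite -(addrr2 x) MXU.
have [|f f_inj fM] := vspace_sum_iso XU0 dW; first by rewrite dimv_compl dim_rVF2.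
exists f => // v vN; have [x [u [xX uU -> x0]]] := fM v.
by apply: MXU => //; apply: contraNneq (NW _ vN) => /x0.
Qed.

(** * Passing to coordinates on the span of [M] *)

Theorem theorem3p2 (R : realType) (k : nat) (N : matroid k) (eps : R)
    (eps_gt0 : 0 < eps) :
  exists (delta : R) (r0 : nat),
    0 < delta /\ (0 < r0)%N /\
    forall (r m : nat) (M : matroid m),
      (r0 <= r)%N ->
      matroid_free N M ->
      rank M = r ->
      (1 - 2 ^ (1 - (critical_number N)%:Z) - delta) * 2 ^+ r
        <= #|mset M|%:R ->
      exists (iota : {linear 'rV['F_2]_r -> 'rV['F_2]_m}) (B B0 : matroid r),
        injective iota /\
        mset M \subset [set iota x | x in [set: 'rV['F_2]_r]] /\
        is_bose_burton (critical_number N).-1 B0 /\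
        matroid_iso B B0 /\
        #|symdiff (mset M) [set iota x | x in mset B]|%:R < eps * 2 ^+ r.
Proof.
have [W [dW NW]] : is_disjoint_codim N (critical_number N).
  by rewrite /critical_number; case: ex_minnP => c /asboolP.
have [delta [r0 [delta_gt0 r0_gt0 Hr0]]] :=
  blowup_free_stability (critical_number N).-1 (\dim W) eps_gt0.
exists delta, (maxn r0 k); split=> //; split; first by rewrite leq_max r0_gt0.
move=> r m M; rewrite geq_max => /andP[r0r kr] NfreeM rM Mbig.
have [T [dT MT]] : is_spanning_dim M r.
  by rewrite -rM /rank; case: ex_minnP => d /asboolP.
(* [iota] identifies the [r]-dimensional space with [T]; [M'] below is [M] in these coordinates. *)
have [|iota [iotaT iota_inj0 iota_surj]] := vspace_iso (A := {: 'rV['F_2]_r}%VS) (B := T).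
  by rewrite dim_rVF2 dT.
have iota_inj : injective iota.
  by apply/lker0P; rewrite -subv0; apply/subvP=> v; rewrite memv_ker memv0
     => /eqP/iota_inj0->; rewrite ?memvf.
pose M' := [set x | iota x \in M].
have M'0 : 0 \notin M' by rewrite inE linear0 (mset_notin0 M).
have M_iota : mset M = iota @: M'.
  apply/setP=> y; apply/idP/imsetP => [yM|[x + ->]]; last by rewrite inE.
  by have [x xy] := iota_surj y (MT y yM); exists x; rewrite ?inE xy.
have noblow X U : \dim X = critical_number N -> \dim U = \dim W -> ~ blowup M' X U.
  move=> dX dU M'XU; apply: NfreeM.
  have [|f f_inj fN] := blowup_embedding M'0 M'XU NW (esym dU); first by rewrite dW.
  exists ((iota \o f)%VF @: mset N); split.
    by apply/subsetP=> _ /imsetP[x /fN fx ->]; rewrite comp_lfunE; move: fx; rewrite inE.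
  exists (iota \o f)%VF; split=> // x y; rewrite /= !comp_lfunE => /iota_inj.
  exact: f_inj.
(* Otherwise the zero subspace is vacuously blown up and [N] embeds in [M]; [k <= r] makes room for
   [U]. *)
have c_gt0 : (0 < critical_number N)%N.
  rewrite lt0n; apply/eqP => c0.
  have [U dU] : exists U : {vspace 'rV['F_2]_r}, \dim U = \dim W.
    have dWr : (\dim W <= \dim {: 'rV['F_2]_r})%N.
      by rewrite dim_rVF2 (leq_trans _ kr) // -[leqRHS]dim_rVF2 dimvS ?subvf.
    exists <<take (\dim W) (vbasis {: 'rV['F_2]_r})>>%VS.
    have := basis_free (vbasisP {: 'rV['F_2]_r}).
    rewrite -{1}(cat_take_drop (\dim W) (vbasis _)) => /catl_free.
    by rewrite /free size_takel ?size_tuple // => /eqP.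
  apply: (noblow 0%VS U) => //; first by rewrite dimv0 c0.
  by move=> x u; rewrite memv0 => ->.
have [||L [dL ML]] := Hr0 r M' r0r M'0.
- by rewrite prednK.
- have -> : (2 ^+ (critical_number N).-1)^-1 = 2 ^ (1 - (critical_number N)%:Z) :> R.
    by rewrite exprnN; congr (_ ^ _); move: c_gt0; lia.
  have cM : #|M'|%:R + #|~: M'|%:R = 2 ^+ r :> R.
    by rewrite -natrD cardsC card_rVF2 natrX.
  move: Mbig; rewrite M_iota (card_imset _ iota_inj) !mulrDl !mulNr mul1r -{1}cM.
  by rewrite -addrA -opprD lerBlDr lerD2l.
have L0 : 0 \notin [set x | x \notin L] by rewrite inE negbK mem0v.
exists iota, (Matroid L0), (Matroid L0); split=> //; split.
  by rewrite M_iota imsetS // subsetT.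
split; first by exists L.
split.
  by exists idfun; split; [exists id | exact: imset_id].
apply: le_lt_trans ML; rewrite ler_nat -(card_imset _ iota_inj).
apply/subset_leq_card/subsetP => y; rewrite M_iota.
case/setUP=> /setDP[/imsetP[x xA ->] xB]; apply/imsetP; exists x => //;
  apply/setUP; [left|right]; apply/setDP; split=> //;
  by apply: contra xB => xB; apply: imset_f.
Qed.
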